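(* Let $n,r$ be positive integers and $s=\gcd(n,r)$. The non-trivial blocks of the block diagonal form of the defining matrix $H_{\mathcal P}$ of the $n\times r$ quantized extended algebra $\mathcal P_q$ are: $n+r-1$ blocks of the form $\begin{pmatrix}0&1\\-1&0\end{pmatrix}$ together with $\tfrac12\big((n-1)(r-1)-s+1\big)$ blocks of the form $\begin{pmatrix}0&2\\-2&0\end{pmatrix}$.
   Context: $N_r$ is the $r\times r$ matrix with all entries on and above the diagonal equal to $-1$ and zeros below the diagonal; $M_r=-N_r^t$. Let $\mathbb I$ be the $r\times r$ identity and, for $\alpha=1,\dots,n$, let $\hat E_\alpha$ be the $r\times n$ matrix whose $\alpha$-th column consists of ones and whose other entries are $0$. $H_{\mathcal P}$ is the skew-symmetric integer matrix of size $nr+r+n$ $$H_{\mathcal P}=\begin{pmatrix}0&2M_r&\cdots&2M_r&\mathbb I&\hat E_1\\2N_r&0&\cdots&2M_r&\mathbb I&\hat E_2\\ \vdots&\vdots&\ddots&\vdots&\vdots&\vdots\\2N_r&2N_r&\cdots&0&\mathbb I&\hat E_n\\-\mathbb I&-\mathbb I&\cdots&-\mathbb I&0&0\\-\hat E_1^t&-\hat E_2^t&\cdots&-\hat E_n^t&0&0\end{pmatrix},$$ i.e. the upper left part has $n\times n$ blocks of size $r\times r$, with diagonal blocks $0$, $2M_r$ above and $2N_r$ below the diagonal. (It encodes the $q$-commutation exponents of the quasi-polynomial algebra associated with $\mathcal P_q$, using the generators $W_{\alpha j}$ of the Dipper–Donkin algebra together with the column operators and the row operators.) A block diagonal form of a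 skew-symmetric integer matrix $J$ of size $N$ and corank $c$ is a matrix $L^tJL=\operatorname{Diag}(D_1,\dots,D_k,0,\dots,0)$, with $L$ an integer matrix of determinant $\pm1$, $k=\tfrac12(N-c)$, and each $D_i=\begin{pmatrix}0&h_i\\-h_i&0\end{pmatrix}$ nonzero (a ''non-trivial block''); blocks are considered up to order and up to the sign of $h_i$. *)

(* Defs.v *)
From mathcomp Require Import all_boot all_order all_algebra.

Set Implicit Arguments.
Unset Strict Implicit.
Unset Printing Implicit Defensive.

Import GRing.Theory Num.Theory.
Local Open Scope ring_scope.

Definition Nmx (r : nat) : 'M[int]_r := \matrix_(i, j) (if (i <= j)%N then -1 else 0).

Definition Mmx (r : nat) : 'M[int]_r := - (Nmx r)^T.

Definition Emx (n r : nat) (a : 'I_n) : 'M[int]_(r, n) :=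
  \matrix_(i, j) (if j == a then 1 else 0).

(* The top left corner has size \sum_(a < n) r, i.e. n * r: this is the shape *)
(* of an n x n array of r x r blocks in the library.                          *)
Definition HP (n r : nat) : 'M[int]_(\sum_(a < n) r + (r + n)) :=
  block_mx
    (\mxblock_(a < n, b < n)
       (if (a < b)%N then 2 *: Mmx r else if (b < a)%N then 2 *: Nmx r else 0))
    (\mxcol_(a < n) row_mx 1%:M (Emx r a))
    (\mxrow_(b < n) col_mx (- 1%:M) (- (Emx r b)^T))
    0.

(* The N x N matrix Diag(D_1, ..., D_k, 0, ..., 0), where D_(i+1) has rows    *)
(* (0, h`_i) and (- h`_i, 0) and k = size h; the trailing zeros come from the *)
(* default value of h`_i. It is meaningful when 2 * size h <= N.              *)
Definition blockdiag (N : nat) (h : seq int) : 'M[int]_N :=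
  \matrix_(i, j)
    if ~~ odd i && (j == i.+1 :> nat) then h`_(i./2)
    else if ~~ odd j && (i == j.+1 :> nat) then - h`_(j./2)
    else 0.

Definition corank (N : nat) (J : 'M[int]_N) : nat :=
  (N - \rank (map_mx (intr : int -> rat) J))%N.

(* h lists the h_i of the non-trivial blocks of a block diagonal form of J. *)
Definition is_block_diagonal_form (N : nat) (J : 'M[int]_N) (h : seq int) : Prop :=
  [/\ all (fun x => x != 0) h,
      (size h).*2 = (N - corank J)%N
    & exists L : 'M[int]_N,
        (\det L = 1 \/ \det L = -1) /\ L^T *m J *m L = blockdiag N h].

(* Main.v *)
(* Let H1 be HP with its upper left block divided by 2. Over every field F,
   the vectors (x, u, v) of the left kernel of H1 are described by functions
   W on [0, n + r) with v_a = - W(n-1-a), u_j = W(n+j) and x_(a,i) = W(n+i-a)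
   - W(n+i-a-1), where W has periods n and r, and hence gcd(n, r) too. So H1
   has corank gcd(n, r) over every field, and all its nontrivial blocks are
   +-1: there is an integer G1 with H1 G1 H1 = H1. Since HP diag(1, 2) =
   diag(2, 1) H1, it follows that HP G HP = 2 HP for G = diag(1, 2) G1
   diag(1, 2), which forces every h_i to divide 2. The rank of HP over Q
   counts the blocks, and its rank modulo 2, where the upper left part
   vanishes, counts those with h_i = +-1. Existence is the general normal
   form of skew-symmetric integer matrices. *)
Require Import Defs.
From mathcomp Require Import all_boot all_order all_algebra.
From mathcomp Require Import zify ring.
Import Order.TTheory GRing.Theory Num.Theory.
Local Open Scope ring_scope.

Set Implicit Arguments.
Unset Strict Implicit.
Unset Printing Implicit Defensive.

(** * Direct sums of skew 2 by 2 blocks *)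

Lemma blockdiag0 N : blockdiag N [::] = 0.
Proof.
by apply/matrixP=> i j; rewrite !mxE !nth_nil oppr0 !if_same.
Qed.

Lemma blockdiag_scale N d h :
  blockdiag N [seq d * x | x <- h] = d *: blockdiag N h.
Proof.
have nthM k : [seq d * x | x <- h]`_k = d * h`_k.
  have [lt_kh | le_hk] := ltnP k (size h); first by rewrite (nth_map 0).
  by rewrite !nth_default ?size_map ?mulr0.
apply/matrixP=> i j; rewrite !mxE !nthM.
by case: ifP => // _; case: ifP => _; rewrite ?mulrN ?mulr0.
Qed.

Lemma blockdiag_cons m x h :
  blockdiag (2 + m) (x :: h)
  = block_mx (x *: blockdiag 2 [:: 1]) 0 0 (blockdiag m h) :> 'M_(2 + m).
Proof.
apply/matrixP=> i j; rewrite !mxE.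
case: splitP => i' def_i; rewrite !mxE; case: splitP => j' def_j;
  rewrite !mxE ?def_i ?def_j //.
- by case: i' j' {def_i def_j} => [[|[|//]] ?] [[|[|//]] ?] /=;
    rewrite ?mulrN ?mulr1 ?mulr0.
- by case: i' {def_i} => [[|[|//]] ?] /=; rewrite ?andbF.
- by case: j' {def_j} => [[|[|//]] ?] /=; rewrite ?andbF.
by rewrite !addSn !add0n /= !negbK !eqSS.
Qed.

Lemma blockdiag2_sqr :
  blockdiag 2 [:: 1] *m blockdiag 2 [:: 1] = - 1%:M.
Proof.
apply/matrixP=> i j; rewrite !mxE !big_ord_recl big_ord0 !mxE.
by case: i j => [[|[|//]] ?] [[|[|//]] ?].
Qed.

Lemma tr_blockdiag2 : (blockdiag 2 [:: 1])^T = - blockdiag 2 [:: 1].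
Proof.
apply/matrixP=> i j; rewrite !mxE.
by case: i j => [[|[|//]] ?] [[|[|//]] ?].
Qed.

(** * Normal form of skew-symmetric integer matrices *)

(** In a Smith form [L *m D *m R] of [Q], only the top square part [D0] of [D] is nonzero. The left
    inverse [A] forces [D0 *m R] to be invertible, so the last [m] columns of [L] complete [Q]. *)
Lemma unimodular_extension (k m : nat) (Q : 'M[int]_(k + m, k)) A :
  A *m Q = 1%:M -> exists Q' : 'M_(k + m, m), row_mx Q Q' \in unitmx.
Proof.
have [L uL [R uR [d _ defQ]]] := int_Smith_normal_form Q.
set D := (X in L *m X) in defQ.
have defD : D = col_mx (usubmx D) 0.
  rewrite -[LHS]vsubmxK; congr col_mx; apply/matrixP=> i j; rewrite !mxE /=.
  by rewrite gtn_eqF // ltn_addr.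
move=> AQ1; set D0 := usubmx D in defD.
have uDR : D0 *m R \in unitmx.
  have: lsubmx (A *m L) *m (D0 *m R) = 1%:M.
    rewrite -AQ1 defQ !mulmxA [in RHS]defD; congr (_ *m R).
    by rewrite -{2}[A *m L]hsubmxK mul_row_col mulmx0 addr0.
  by case/mulmx1_unit.
exists (L *m col_mx 0 1%:M).
have -> : row_mx Q (L *m col_mx 0 1%:M)
          = L *m block_mx (D0 *m R) 0 0 1%:M :> 'M_(k + m).
  rewrite block_mxEh mul_mx_row; congr row_mx.
  by rewrite defQ -mulmxA defD mul_col_mx mul0mx.
by rewrite unitmx_mul uL /= unitmxE det_ublock det1 mulr1 -unitmxE.
Qed.

(** Up to sign, [d] is the first invariant factor of [J], which divides all the others. The first
    row of the inverse of [L] and the first column of the inverse of [R] pick out the leading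
    diagonal entry, which is 1 after division. *)
Lemma primitive_value N (J : 'M[int]_N) : J != 0 ->
  exists (d : int) (S : 'M_N) (u : 'rV_N) (v : 'cV_N),
    [/\ 0 < d, J = d *: S & u *m S *m v = 1%:M].
Proof.
case: N J => [|N] J nzJ; first by rewrite [J]flatmx0 eqxx in nzJ.
have [L uL [R uR [d sd defJ]]] := int_Smith_normal_form J.
have dvd_d i : (d`_0 %| d`_i)%Z.
  have [lt_i | le_i] := ltnP i (size d); last by rewrite (nth_default _ le_i).
  by apply: (sorted_leq_nth dvdz_trans dvdzz) => //; rewrite ?inE; case: (d) lt_i.
have nzd : d`_0 != 0.
  apply: contraNneq nzJ => d0; rewrite defJ.
  have -> : (\matrix_(i, j) (d`_i *+ (i == j :> nat)) : 'M_N.+1) = 0.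
    apply/matrixP=> i j; rewrite !mxE.
    by have := dvd_d i; rewrite d0 dvd0z => /eqP->; rewrite mul0rn.
  by rewrite mulmx0 mul0mx.
pose D : 'M[int]_N.+1 := \matrix_(i, j) ((d`_i %/ d`_0)%Z *+ (i == j :> nat)).
pose S := L *m D *m R.
have JS : J = d`_0 *: S.
  rewrite defJ scalemxAl scalemxAr; congr (_ *m _ *m _).
  by apply/matrixP=> i j; rewrite !mxE mulrnAr mulrC divzK ?dvd_d.
have S1 : row 0 (invmx L) *m S *m col 0 (invmx R) = 1%:M.
  rewrite -row_mul /S !mulmxA mulVmx // mul1mx colE mulmxA -row_mul.
  rewrite -mulmxA mulmxV // mulmx1 -row_mul -colE.
  by apply/matrixP=> i j; rewrite !ord1 !mxE /= divzz nzd.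
(* The sign of the invariant factor moves into [S], and is cancelled by the same sign on [u]. *)
exists `|d`_0|, (sgz d`_0 *: S), (sgz d`_0 *: row 0 (invmx L)), (col 0 (invmx R)).
split; first by rewrite normr_gt0.
  by rewrite scalerA JS [in LHS](intEsg d`_0) mulrC abszE.
rewrite -!scalemxAl -scalemxAr -!scalemxAl scalerA S1.
by rewrite mulz_sg nzd scale1r.
Qed.

(* With J = d S and u S v = 1, S is unimodular on the span of u and v, so these
   extend to a basis of Z^N and a Schur complement splits off their span. As d
   divides J, the later h_i are multiples of d, hence h is sorted. *)
Lemma skew_normal_form N (J : 'M[int]_N) : J^T = - J ->
  exists (L : 'M_N) (h : seq int),
    [/\ L \in unitmx, all (fun x => 0 < x) h, sorted <=%R h,
        ((size h).*2 <= N)%N & L^T *m J *m L = blockdiag N h].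
Proof.
have eqN0 (x : int) : x = - x -> x = 0 by lia.
have [m le_Nm] := ubnP N; elim: m => // m IHm in N le_Nm J *; move=> skJ.
have [->|nzJ] := eqVneq J 0.
  by exists 1%:M, [::]; rewrite unitmx1 mulmx0 mul0mx blockdiag0.
have [d [S [u [v [d_gt0 defJ uSv]]]]] := primitive_value nzJ.
have skS : S^T = - S.
  apply/matrixP=> i j; move/matrixP/(_ i j): skJ.
  by rewrite defJ !mxE -mulrN => /(mulfI (lt0r_neq0 d_gt0)).
case: N => [|[|N]] in le_Nm J skJ nzJ S u v defJ uSv skS *.
- by rewrite [J]flatmx0 eqxx in nzJ.
- case/eqP: nzJ; apply/matrixP=> i j; rewrite !ord1.
  by move/matrixP/(_ 0 0): skJ; rewrite !mxE => /eqN0.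
pose E := blockdiag 2 [:: 1].
have EE : E *m E = - 1%:M := blockdiag2_sqr.
have trE : E^T = - E := tr_blockdiag2.
have sq0 (w : 'rV_N.+2) : w *m S *m w^T = 0.
  apply/matrixP=> i j; rewrite !ord1 [RHS]mxE; set A := _ *m _.
  have: A^T = - A by rewrite /A !trmx_mul trmxK skS mulNmx mulmxN mulmxA.
  by move/matrixP/(_ 0 0); rewrite mxE [RHS]mxE => /eqN0.
pose Q : 'M_(2 + N, 1 + 1) := row_mx u^T v.
have QSQ : Q^T *m S *m Q = E.
  rewrite /Q tr_row_mx trmxK mul_col_mx mul_col_row uSv sq0.
  have := sq0 v^T; rewrite trmxK => ->.
  have -> : v^T *m S *m u^T = - 1%:M.
    by apply: trmx_inj; rewrite !trmx_mul !trmxK skS mulNmx mulmxN mulmxA uSv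
      linearN /= tr_scalar_mx.
  apply/matrixP=> i j; rewrite !mxE.
  by case: splitP => i' def_i; rewrite !mxE; case: splitP => j' def_j;
    rewrite !mxE ?def_i ?def_j ?ord1.
have [Q' uP] : exists Q' : 'M_(2 + N, N), row_mx Q Q' \in unitmx.
  (* The left inverse comes from [Q^T *m S *m Q = E] and the fact that [- E] is the inverse of
     [E]. *)
  apply: (@unimodular_extension 2 N Q (- E *m Q^T *m S)).
  by rewrite -!mulmxA (mulmxA Q^T) QSQ mulNmx EE opprK.
set P := row_mx Q Q' in uP.
pose B := Q^T *m S *m Q'; pose C := Q'^T *m S *m Q'.
have PSP : P^T *m S *m P = block_mx E B (- B^T) C.
  rewrite /P tr_row_mx mul_col_mx mul_col_row QSQ -/B -/C.
  by rewrite /B !trmx_mul trmxK skS mulNmx mulmxN opprK mulmxA.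
clearbody B C.
have trEB : (E *m B)^T = - (B^T *m E) by rewrite [LHS]trmx_mul trE mulmxN.
(* As [E] squares to -1, the corner [E *m B] solves E X + B = 0, which clears the off-diagonal
   blocks. *)
pose T : 'M_(2 + N) := block_mx 1%:M (E *m B) 0 1%:M.
have uT : T \in unitmx by rewrite unitmxE det_ublock !det1 mulr1 unitr1.
pose C' := C - B^T *m E *m B.
have PTS : (P *m T)^T *m S *m (P *m T) = block_mx E 0 0 C'.
  rewrite trmx_mul !mulmxA -(mulmxA _ P^T) -(mulmxA _ _ P) PSP.
  rewrite /T tr_block_mx !mulmx_block !trmx1 trmx0 trEB.
  rewrite !mul0mx !mulmx0 !mul1mx !mulmx1 !addr0 !mulmxA EE.
  rewrite !mulNmx !mul1mx -(mulmxA B^T) EE mulmxN mulmx1 opprK subrr !mul0mx.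
  by congr block_mx; rewrite ?add0r ?addNr // addrC.
have skC' : C'^T = - C'.
  have: (block_mx E 0 0 C')^T = - block_mx E 0 0 C' :> 'M_(2 + N).
    rewrite -PTS !trmx_mul !trmxK skS; rewrite !(mulNmx, mulmxN) !mulmxA //.
  rewrite tr_block_mx opp_block_mx => /eq_block_mx[_ _ _ //].
have [|L [h [uL h_gt0 sh le_h LCL]]] := IHm N _ C' skC'; first by lia.
pose K : 'M_(2 + N) := block_mx 1%:M 0 0 L.
have uK : K \in unitmx by rewrite unitmxE det_ublock det1 mul1r -unitmxE.
exists (P *m T *m K), (d :: [seq d * x | x <- h]); split.
- by rewrite !unitmx_mul uP uT.
- rewrite /= d_gt0 all_map; apply: sub_all h_gt0 => x x_gt0 /=.
  exact: mulr_gt0.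
- rewrite /= path_sortedE; last exact: le_trans.
  rewrite all_map (sub_all _ h_gt0) /=; last first.
    by move=> x x_gt0 /=; rewrite ler_peMr // ltW.
  by rewrite sorted_map; apply: sub_sorted sh => x y /= le_xy; rewrite ler_pM2l.
- by rewrite /= size_map doubleS.
have -> : (P *m T *m K)^T *m J *m (P *m T *m K)
          = d *: (K^T *m ((P *m T)^T *m S *m (P *m T)) *m K).
  by rewrite defJ trmx_mul -!(scalemxAl, scalemxAr) !mulmxA.
rewrite PTS /K tr_block_mx !mulmx_block !trmx0 !trmx1.
rewrite !(mul0mx, mulmx0, mul1mx, mulmx1, addr0, add0r) LCL.
by rewrite scale_block_mx !scaler0 -blockdiag_scale -blockdiag_cons.
Qed.

(** * Ranks and uniqueness of block diagonal forms *)

Lemma rank_blockdiag (F : fieldType) N h : ((size h).*2 <= N)%N ->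
  \rank (map_mx (intr : int -> F) (blockdiag N h))
  = (count (fun x : int => x%:~R != 0 :> F) h).*2.
Proof.
elim: h N => [|x h IHh] [|[|N]] //= le_hN; rewrite ?blockdiag0 ?raddf0 ?mxrank0 //.
rewrite -[N.+2]/(2 + N)%N (blockdiag_cons N x h) map_block_mx !map_mx0 rank_diag_block_mx.
rewrite IHh // doubleD; congr (_ + _)%N; rewrite map_mxZ /=.
case: eqP => [->|/eqP nz_x]; first by rewrite scale0r mxrank0.
rewrite mxrank_scale_nz // mxrank_unit // unitmxE.
have: map_mx intr (blockdiag 2 [:: 1]) *m map_mx intr (blockdiag 2 [:: 1])
      = - 1%:M :> 'M[F]_2.
  by rewrite -map_mxM blockdiag2_sqr raddfN /= map_mx1.
move/(congr1 -%R); rewrite opprK -mulmxN => /mulmx1_unit[].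
by rewrite unitmxE.
Qed.

Lemma rank_congr (F : fieldType) N (J L : 'M[int]_N) : L \in unitmx ->
  \rank (map_mx (intr : int -> F) (L^T *m J *m L))
  = \rank (map_mx (intr : int -> F) J).
Proof.
move=> uL; have uLF : map_mx (intr : int -> F) L \in unitmx.
  by rewrite unitmxE det_map_mx rmorph_unit -?unitmxE.
rewrite !map_mxM -map_trmx mxrankMfree ?row_free_unit //.
by rewrite (eqmxMfull _ (A := _^T)) // row_full_unit unitmx_tr.
Qed.

Lemma det_pm1_unitmx N (L : 'M[int]_N) :
  (\det L = 1 \/ \det L = -1) <-> L \in unitmx.
Proof.
rewrite unitmxE unfold_in /=; split=> [[]->//|/orP[]/eqP]; by [left|right].
Qed.

Lemma perm_eq_nseq12 (s : seq int) : all (fun x => (x == 1) || (x == 2)) s ->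
  perm_eq s (nseq (count_mem 1 s) 1 ++ nseq (count_mem 2 s) 2).
Proof.
elim: s => //= x s IHs /andP[/orP[]/eqP-> /IHs{}IHs] /=.
  by rewrite add0n perm_cons.
by rewrite add0n perm_sym perm_catC /= perm_cons perm_catC perm_sym.
Qed.

Lemma blockdiag_weak_inverse2 N h (G : 'M[int]_N) : ((size h).*2 <= N)%N ->
  all (fun x => x != 0) h ->
  blockdiag N h *m G *m blockdiag N h = 2 *: blockdiag N h ->
  all (fun x => (`|x| == 1) || (`|x| == 2)) h.
Proof.
move=> le_hN nz_h DGD; apply/(all_nthP 0) => i lt_ih.
have nz_hi : h`_i != 0 by apply: (all_nthP 0 nz_h).
have lt1 : (i.*2.+1 < N)%N by apply: leq_trans le_hN; rewrite -doubleS leq_double.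
have lt0 := ltnW lt1.
pose a := Ordinal lt0; pose b := Ordinal lt1.
have Drow j : blockdiag N h a j = if j == b then h`_i else 0.
  rewrite mxE /= odd_double /= -val_eqE /= doubleK; case: ifP => // _.
  by case: ifP => // /andP[odd_j /eqP/(congr1 odd)]; rewrite /= odd_double odd_j.
have Dcol j : blockdiag N h j b = if j == a then h`_i else 0.
  rewrite mxE /= odd_double /= eqSS -[j == a]val_eqE /= [i.*2 == _]eq_sym.
  case: eqP => [->|]; first by rewrite odd_double doubleK.
  by rewrite andbF.
move/matrixP/(_ a b): DGD; rewrite mxE [RHS]mxE Drow eqxx.
rewrite (bigD1 a) //= big1 => [|j /negPf j_a]; last by rewrite Dcol j_a mulr0.
rewrite Dcol eqxx addr0 mxE (bigD1 b) //= big1 => [|j /negPf j_b]; last first.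
  by rewrite Drow j_b mul0r.
rewrite Drow eqxx addr0 [h`_i * _]mulrC => /(mulIf nz_hi) g_hi.
have: (h`_i %| 2)%Z by apply/dvdzP; exists (G b a).
move: (h`_i) nz_hi => x nz_x; rewrite dvdzE => /dvdn_leq-/(_ isT) /=; lia.
Qed.

(** The weak inverse bounds every |h_i| by 2. The rational rank then counts all blocks, while the
    rank modulo 2 counts only those with h_i = 1 or -1. *)
Lemma block_diagonal_form_perm N (J G : 'M[int]_N) (a b : nat) h :
  J *m G *m J = 2 *: J ->
  \rank (map_mx (intr : int -> rat) J) = (a + b).*2 ->
  \rank (map_mx (intr : int -> 'F_2) J) = a.*2 ->
  is_block_diagonal_form J h ->
  perm_eq [seq `|x| | x <- h] (nseq a (1 : int) ++ nseq b (2 : int)).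
Proof.
move=> JGJ rkQ rkF2 [nz_h sz_h [L [/det_pm1_unitmx uL LJL]]].
have le_hN : ((size h).*2 <= N)%N by rewrite sz_h leq_subr.
have h12 : all (fun x => (`|x| == 1) || (`|x| == 2)) h.
  (* Under the congruence by [L], the matrix [G] is transported by the inverse of [L]. *)
  apply: (@blockdiag_weak_inverse2 N h (invmx L *m G *m (invmx L)^T)) => //.
  rewrite -LJL !mulmxA mulmxK // trmx_inv mulmxKV ?unitmx_tr //.
  by rewrite -2!(mulmxA L^T) JGJ -scalemxAr -scalemxAl.
have := rank_congr 'F_2 J uL; rewrite LJL rank_blockdiag // rkF2.
have := rank_congr rat J uL; rewrite LJL rank_blockdiag // rkQ.
rewrite (eq_count (a2 := predC1 0)); last by move=> x; rewrite /= intr_eq0.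
have := nz_h; rewrite all_count => /eqP->.
move=> /double_inj sz_ab /double_inj cnt_a.
have cnt1 : count_mem 1 [seq `|x| | x <- h] = a.
  rewrite -cnt_a count_map; apply: eq_in_count => x /(allP h12).
  case: x => [[|[|[|//]]]|[|[|//]]] //.
have cnt2 : count_mem 2 [seq `|x| | x <- h] = b.
  apply: (@addnI a); rewrite -sz_ab -cnt1 !count_map.
  rewrite -(count_predC (preim (fun x : int => `|x|) (pred1 1)) h).
  congr (_ + _)%N; apply: eq_in_count => x /(allP h12) /=.
  by case: eqP => [->|].
rewrite -cnt1 -cnt2; apply: perm_eq_nseq12.
by rewrite all_map.
Qed.

(** * Sequences with two periods, and diagonal recurrences on a grid *)

(** A form of the Fine-Wilf theorem, proved by Euclid's algorithm: for n <= r, the periods n and r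
    on [0, n + r) give the periods n and r - n on [0, r). The remaining indices are reached by
    subtracting r. *)
Lemma two_periods T (W : nat -> T) n r :
  (forall k, (k < r)%N -> W (k + n)%N = W k) ->
  (forall k, (k < n)%N -> W (k + r)%N = W k) ->
  forall k, (k < n + r)%N -> W k = W (k %% gcdn n r)%N.
Proof.
have [m] := ubnP (n + r); elim: m => // m IHm in n r *.
wlog le_nr : n r / (n <= r)%N => [IH | lt_m Wn Wr].
  have [/IH//|/ltnW le_rn] := leqP n r.
  by rewrite addnC gcdnC => lt_m Wn Wr; apply: IH.
case: n => [|n] in le_nr lt_m Wn Wr *.
  by move=> k lt_kr; rewrite gcd0n modn_small.
have [q def_r] : exists q, r = (q + n.+1)%N by exists (r - n.+1)%N; lia.
have gcdE : gcdn n.+1 q = gcdn n.+1 r by rewrite def_r gcdnDr.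
have Wlt k : (k < r)%N -> W k = W (k %% gcdn n.+1 r)%N.
  move=> lt_kr; rewrite -gcdE; apply: IHm; try lia.
    by move=> l lt_lq; apply: Wn; lia.
  by move=> l lt_ln; rewrite -(Wr l lt_ln) -Wn ?def_r ?addnA //; lia.
move=> k lt_k; have [/Wlt//|le_rk] := ltnP k r.
rewrite -(subnK le_rk) Wr; last lia.
rewrite Wlt; last lia.
by congr W; rewrite -modnDmr (eqP (dvdn_gcdr _ _)) addn0.
Qed.

Section StaircaseSystem.

Variables (V : comNzRingType) (n r : nat).

(** Joining [- v], read backwards, and [u] into one sequence W turns the diagonal increment u_j +
    v_a into W(n+j) - W(n-a-1), a difference of values of a single function. *)
Definition window (u v : nat -> V) (k : nat) : V :=
  if (k < n)%N then - v (n - k.+1)%N else u (k - n)%N.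

Definition psum (W : nat -> V) k := \sum_(l < k) W l.

Lemma psumS W k : psum W k.+1 = psum W k + W k.
Proof. exact: big_ord_recr. Qed.

(* The corner sums of the kernel vector x attached to W, in closed form. *)
Definition stair (W : nat -> V) a j :=
  psum W (n + j) + psum W (n - a) - psum W (n + j - a) - psum W n.

Lemma stair_step W a j : (a < n)%N ->
  stair W a.+1 j.+1 = stair W a j + W (n + j)%N - W (n - a.+1)%N.
Proof.
move=> lt_an; rewrite /stair addnS subSS psumS.
rewrite (_ : (n - a)%N = (n - a.+1).+1) ?psumS; last lia.
ring.
Qed.

Lemma stair0l W j : stair W 0 j = 0.
Proof. by rewrite /stair !subn0; ring. Qed.

Lemma stair0r W a : stair W a 0 = 0.
Proof. by rewrite /stair addn0; ring. Qed.

(** Every grid point is reached along a diagonal from the left or the top edge, so the zero values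
    there and the diagonal increments determine [P]; [stair] has the same ones. *)
Lemma stairP (u v : nat -> V) (P : nat -> nat -> V) :
  (forall j, P 0 j = 0) -> (forall a, P a 0 = 0) ->
  (forall a j, (a < n)%N -> (j < r)%N -> P a.+1 j.+1 = P a j + u j + v a) ->
  forall a j, (a <= n)%N -> (j <= r)%N -> P a j = stair (window u v) a j.
Proof.
move=> P0l P0r PS; elim=> [|a IHa] [|j] le_an le_jr;
  rewrite ?stair0l ?stair0r ?P0l ?P0r //.
rewrite PS // stair_step // IHa ?(ltnW le_an) ?(ltnW le_jr) // /window.
have -> : (n + j < n)%N = false by lia.
have -> : (n - a.+1 < n)%N by lia.
by rewrite addKn opprK; congr (_ + _ + v _); lia.
Qed.

(** The two far edges give the two periods: along the edge a = n the increment of [stair] is W(n+j)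
    - W(j), and along the edge j = r it is W(k+r) - W(k) with k = n-a-1. Both vanish with [P]. *)
Lemma window_periodic (u v : nat -> V) (P : nat -> nat -> V) (W := window u v) :
  (forall j, P 0 j = 0) -> (forall a, P a 0 = 0) ->
  (forall j, P n j = 0) -> (forall a, P a r = 0) ->
  (forall a j, (a < n)%N -> (j < r)%N -> P a.+1 j.+1 = P a j + u j + v a) ->
  forall k, (k < n + r)%N -> W k = W (k %% gcdn n r)%N.
Proof.
move=> P0l P0r Pn Pr PS; have PE := stairP P0l P0r PS.
apply: two_periods => [j lt_jr | k lt_kn].
  have: stair W n j.+1 = stair W n j by rewrite -!PE ?Pn ?(ltnW lt_jr).
  rewrite /stair subnn addnS !psumS -addnS !addKn psumS => /eqP.
  rewrite -subr_eq0 => /eqP/esym.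
  rewrite [(j + n)%N]addnC => eqW; apply/eqP; rewrite -subr_eq0; apply/eqP.
  by rewrite {}eqW; ring.
pose a := (n - k.+1)%N.
have: stair W a.+1 r = stair W a r by rewrite -!PE ?Pr ?leq_subr //; lia.
rewrite /stair.
have -> : (n - a.+1 = k)%N by lia.
have -> : (n - a = k.+1)%N by lia.
have -> : (n + r - a.+1 = k + r)%N by lia.
have -> : (n + r - a = (k + r).+1)%N by lia.
rewrite !psumS => /eqP; rewrite -subr_eq0 => /eqP/esym eqW.
by apply/eqP; rewrite -subr_eq0; apply/eqP; rewrite {}eqW; ring.
Qed.

End StaircaseSystem.

(** * Bordered matrices with a scaling parameter *)

Section Border.

Variables (R : comNzRingType) (n r : nat).

Definition stair_mx : 'M[R]_(\sum_(a < n) r) :=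
  \mxblock_(a < n, b < n) \matrix_(i < r, j < r)
    (((a < b) && (j <= i))%N%:R - ((b < a) && (i <= j))%N%:R).

(** This is the unsigned incidence matrix of the complete bipartite graph on r + n vertices, whose
    edges are the pairs (a, i). *)
Definition incidence_mx : 'M[R]_(\sum_(a < n) r, r + n) :=
  \mxcol_(a < n) row_mx 1%:M (\matrix_(i < r, b < n) (b == a)%:R).

(** The value c = 2 gives [HP] and c = 1 gives H1. The ring is left general so that the same matrix
    can be read over each field. *)
Definition bordered_mx (c : R) : 'M[R]_(\sum_(a < n) r + (r + n)) :=
  block_mx (c *: stair_mx) incidence_mx (- incidence_mx^T) 0.

End Border.

Lemma HP_bordered n r : HP n r = bordered_mx n r 2.
Proof.
rewrite /HP /bordered_mx; congr block_mx.
- apply/matrixP=> i j; rewrite !mxE.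
  set a := tagnat.sig1 i; set b := tagnat.sig1 j; clearbody a b.
  case: ltngtP => ab; rewrite !mxE /= ?opprK.
  + by case: ifP; rewrite ?subr0 ?opprK ?oppr0.
  + by case: ifP; rewrite ?sub0r ?subr0.
  + by rewrite subr0 mulr0.
- apply/matrixP=> i j; rewrite !mxE; case: split => k; rewrite !mxE //.
  by case: ifP.
rewrite /incidence_mx tr_mxcol.
apply/matrixP=> i j; rewrite !mxE; case: split => k; rewrite !mxE //.
  by rewrite eq_sym.
by case: ifP.
Qed.

Lemma map_bordered (F : fieldType) n r (c : int) :
  map_mx intr (bordered_mx n r c) = bordered_mx n r (c%:~R : F).
Proof.
rewrite /bordered_mx map_block_mx map_mx0 map_mxN -map_trmx; congr block_mx.
- by apply/matrixP=> i j; rewrite !mxE rmorphM rmorphB !rmorph_nat.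
- apply/matrixP=> i j; rewrite !mxE; case: split => k; rewrite !mxE;
    exact: rmorph_nat.
congr (- _); apply/matrixP=> i j; rewrite !mxE; case: split => k; rewrite !mxE;
  exact: rmorph_nat.
Qed.

Lemma tr_bordered (R : comNzRingType) n r (c : R) :
  (bordered_mx n r c)^T = - bordered_mx n r c.
Proof.
rewrite /bordered_mx tr_block_mx opp_block_mx !linearN /= trmxK opprK trmx0 oppr0.
congr block_mx; rewrite linearZ -scalerN /=; congr (_ *: _).
by apply/matrixP=> i j; rewrite !mxE opprB.
Qed.

Lemma sum_ord_ltS (V : nmodType) m (f : 'I_m -> V) (k : 'I_m) :
  \sum_(i < m | (i < k.+1)%N) f i = \sum_(i < m | (i < k)%N) f i + f k.
Proof.
rewrite (bigD1 k) //= addrC; congr (_ + _); apply: eq_bigl => i.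
by rewrite -val_eqE /=; lia.
Qed.

(** * The left kernel of the bordered matrix *)

Section Kernel.

Variables (F : fieldType) (n r : nat).
Variables (X : 'I_n -> 'I_r -> F).

(** When all row and column sums of [X] are zero, these partial sums vanish on all four edges of the
    grid, as [window_periodic] requires. *)
Definition corner a j : F := \sum_(b < n | (b < a)%N) \sum_(i < r | (i < j)%N) X b i.

Lemma cornerSl (a : 'I_n) j :
  corner a.+1 j = corner a j + \sum_(i < r | (i < j)%N) X a i.
Proof. exact: sum_ord_ltS. Qed.

Lemma cornerSr a (j : 'I_r) :
  corner a j.+1 = corner a j + \sum_(b < n | (b < a)%N) X b j.
Proof.
rewrite /corner -big_split /=; apply: eq_bigr => b _; exact: sum_ord_ltS.
Qed.

Hypothesis row0 : forall a, \sum_i X a i = 0.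
Hypothesis col0 : forall i, \sum_a X a i = 0.

Lemma corner0l j : corner 0 j = 0. Proof. exact: big_pred0. Qed.

Lemma corner0r a : corner a 0 = 0.
Proof. by apply: big1 => b _; apply: big_pred0. Qed.

Lemma corner_r a : corner a r = 0.
Proof.
by apply: big1 => b _; rewrite -[RHS](row0 b); apply: eq_bigl => i; rewrite ltn_ord.
Qed.

Lemma corner_n j : corner n j = 0.
Proof.
rewrite /corner exchange_big /=; apply: big1 => i _.
by rewrite -[RHS](col0 i); apply: eq_bigl => a; rewrite ltn_ord.
Qed.

Lemma cornerE a j :
  corner a j = \sum_b \sum_i X b i * ((b < a) && (i < j))%N%:R.
Proof.
rewrite /corner big_mkcond; apply: eq_bigr => b _; case: ifP => _ /=.
  by rewrite big_mkcond; apply: eq_bigr => i _; case: ifP; rewrite ?mulr1 ?mulr0.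
by rewrite big1 // => i _; rewrite mulr0.
Qed.

(* Zero row and column sums turn the two opposite quadrants into corners. *)
Lemma stair_sum (b : 'I_n) (j : 'I_r) :
  \sum_a \sum_i X a i * (((a < b) && (j <= i))%N%:R - ((b < a) && (i <= j))%N%:R)
  = corner b.+1 j.+1 - corner b j.
Proof.
have sum_r : \sum_a \sum_i X a i * (a < b)%N%:R = 0.
  by rewrite big1 // => a _; rewrite -mulr_suml row0 mul0r.
have sum_c : \sum_a \sum_i X a i * (i <= j)%N%:R = 0.
  rewrite exchange_big /= big1 // => i _; by rewrite -mulr_suml col0 mul0r.
set lhs := LHS.
(* With the vanishing sums added, X a i has on both sides the coefficient [a <= b][i <= j] -
   [a < b][i < j] + [a < b], so the identity holds term by term. *)
have: lhs + \sum_a \sum_i X a i * (i <= j)%N%:R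
    = corner b.+1 j.+1 - corner b j + \sum_a \sum_i X a i * (a < b)%N%:R.
  rewrite !cornerE -!sumrN -!big_split /=; apply: eq_bigr => a _.
  rewrite -!sumrN -!big_split /=; apply: eq_bigr => i _.
  rewrite -[(j <= i)%N]negbK -ltnNge [(b < a)%N]ltnNge !ltnS.
  by case: (a < b)%N (i < j)%N (a <= b)%N (i <= j)%N => [] [] [] [] /=; ring.
by rewrite sum_r sum_c !addr0.
Qed.

End Kernel.

Section BorderedKernel.

Variables (F : fieldType) (n r : nat).

Definition block_row (X : 'I_n -> 'I_r -> F) : 'rV[F]_(\sum_(a < n) r) :=
  \mxrow_(a < n) \row_(i < r) X a i.

Definition border_row (u : 'I_r -> F) (v : 'I_n -> F) : 'rV[F]_(r + n) :=
  row_mx (\row_j u j) (\row_a v a).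

Lemma block_row_incidence X :
  block_row X *m incidence_mx F n r
  = border_row (fun j => \sum_a X a j) (fun a => \sum_i X a i).
Proof.
rewrite /block_row /incidence_mx mul_mxrow_mxcol /border_row.
under eq_bigr do rewrite mul_mx_row mulmx1.
apply/rowP=> k; rewrite summxE; have [j ->|b ->] := split_ordP k.
  by rewrite row_mxEl mxE; apply: eq_bigr => a _; rewrite row_mxEl mxE.
rewrite row_mxEr mxE (bigD1 b) //= [X in _ + X]big1 => [|a /negPf a_b].
  rewrite addr0 row_mxEr mxE.
  by apply: eq_bigr => i _; rewrite !mxE eqxx mulr1.
by rewrite row_mxEr mxE big1 // => i _; rewrite !mxE eq_sym a_b mulr0.
Qed.

Lemma block_row_stair X :
  block_row X *m stair_mx F n r = block_row (fun b j => \sum_a \sum_i X a i *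
    (((a < b) && (j <= i))%N%:R - ((b < a) && (i <= j))%N%:R)).
Proof.
rewrite /block_row /stair_mx mul_mxrow_mxblock; apply: eq_mxrow => b.
apply/rowP=> j; rewrite summxE !mxE; apply: eq_bigr => a _; rewrite mxE.
by apply: eq_bigr => i _; rewrite !mxE.
Qed.

Lemma border_row_incidence u v :
  border_row u v *m (incidence_mx F n r)^T = block_row (fun b j => u j + v b).
Proof.
rewrite /border_row /incidence_mx tr_mxcol mul_mxrow; apply: eq_mxrow => b.
rewrite tr_row_mx mul_row_col trmx1 mulmx1; apply/rowP=> j; rewrite !mxE.
congr (_ + _); rewrite (bigD1 b) //= big1 => [|a /negPf a_b]; rewrite !mxE.
  by rewrite eqxx mulr1 addr0.
by rewrite a_b mulr0.
Qed.

Lemma block_row_inj X Y : block_row X = block_row Y -> forall a i, X a i = Y a i.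
Proof. by rewrite /block_row => /eq_mxrowP eqXY a i; have /rowP/(_ i) := eqXY a; rewrite !mxE. Qed.

Lemma eq_block_row X Y : (forall a i, X a i = Y a i) -> block_row X = block_row Y.
Proof. by move=> eqXY; apply: eq_mxrow => a; apply/rowP=> i; rewrite !mxE. Qed.

(** The border columns impose the zero row and column sums. Under these, [stair_sum] turns the
    remaining columns into the diagonal recurrence for corners. *)
Lemma bordered_kernelP X u v :
  row_mx (block_row X) (border_row u v) *m bordered_mx n r 1 = 0 <->
  [/\ forall a, \sum_i X a i = 0, forall i, \sum_a X a i = 0 &
      forall (b : 'I_n) (j : 'I_r),
        corner X b.+1 j.+1 = corner X b j + u j + v b].
Proof.
rewrite /bordered_mx mul_row_block scale1r mulmxN mulmx0 addr0.
rewrite block_row_stair border_row_incidence block_row_incidence.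
split=> [|[row0 col0 cornerS]].
  move/eqP; rewrite row_mx_eq0 => /andP[/eqP eqS /eqP eqB].
  have row0 a : \sum_i X a i = 0.
    have := congr1 (fun w => rsubmx w 0 a) eqB.
    by rewrite /border_row row_mxKr !mxE.
  have col0 i : \sum_a X a i = 0.
    have := congr1 (fun w => lsubmx w 0 i) eqB.
    by rewrite /border_row row_mxKl !mxE.
  split=> // b j.
  have /block_row_inj/(_ b j) := subr0_eq eqS.
  rewrite stair_sum // => /eqP; rewrite subr_eq => /eqP->; ring.
apply/eqP; rewrite row_mx_eq0; apply/andP; split.
  rewrite subr_eq0; apply/eqP/eq_block_row => b j.
  by rewrite stair_sum // cornerS; ring.
by rewrite row_mx_eq0; apply/andP; split; apply/eqP/rowP=> i; rewrite !mxE.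
Qed.

(** The first component is the mixed second difference of [stair W], the other two invert
    [window]. *)
Definition window_row (W : nat -> F) : 'rV[F]_(\sum_(a < n) r + (r + n)) :=
  row_mx (block_row (fun a i => W (n + i - a)%N - W (n + i - a.+1)%N))
         (border_row (fun j => W (n + j)%N) (fun a => - W (n - a.+1)%N)).

Local Notation s := (gcdn n r).

Lemma telescope_row (W : nat -> F) (a : 'I_n) m :
  \sum_(i < m) (W (n + i - a)%N - W (n + i - a.+1)%N)
  = W (n + m - a.+1)%N - W (n - a.+1)%N.
Proof.
rewrite -(big_mkord xpredT (fun i => W (n + i - a)%N - W (n + i - a.+1)%N)).
have := telescope_sumr (fun i => W (n + i - a.+1)%N) (leq0n m).
rewrite /= addn0 => <-.
apply: eq_bigr => i _; congr (W _ - _); have := ltn_ord a; lia.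
Qed.

Lemma telescope_col (W : nat -> F) i m : (m <= n)%N ->
  \sum_(a < m) (W (n + i - a)%N - W (n + i - a.+1)%N)
  = W (n + i)%N - W (n + i - m)%N.
Proof.
move=> le_mn; elim: m le_mn => [|m IHm] le_mn.
  by rewrite big_ord0 subn0 subrr.
by rewrite big_ord_recr /= (IHm (ltnW le_mn)); ring.
Qed.

(** Row and column sums telescope to differences of W across r and n, hence vanish. A diagonal step
    of [corner] adds a hook, part of a row and part of a column, which telescopes to W(n+j) -
    W(n-b-1). *)
Lemma window_row_kernel W : (forall k, W (k + s)%N = W k) ->
  window_row W *m bordered_mx n r 1 = 0.
Proof.
move=> Ws; have Wmul q k : W (k + q * s)%N = W k.
  by elim: q => [|q IHq]; rewrite ?addn0 // mulSnr addnA Ws.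
have Wn k : W (k + n)%N = W k by rewrite -(divnK (dvdn_gcdl n r)) Wmul.
have Wr k : W (k + r)%N = W k by rewrite -(divnK (dvdn_gcdr n r)) Wmul.
apply/bordered_kernelP; split=> [a|i|b j].
- rewrite telescope_row; have -> : (n + r - a.+1 = n - a.+1 + r)%N.
    by have := ltn_ord a; lia.
  by rewrite Wr subrr.
- by rewrite telescope_col // addKn addnC Wn subrr.
rewrite cornerSl cornerSr; set X := fun a i => _.
have -> : \sum_(a < n | (a < b)%N) X a j = W (n + j)%N - W (n + j - b)%N.
  rewrite -(telescope_col W j (ltnW (ltn_ord b))).
  have := big_ord_widen n (fun a => W (n + j - a)%N - W (n + j - a.+1)%N).
  by move=> /(_ _ _ _ (ltnW (ltn_ord b)))->.
have -> : \sum_(i < r | (i < j.+1)%N) X b i = W (n + j - b)%N - W (n - b.+1)%N.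
  rewrite -subSS -addnS -telescope_row.
  by rewrite (big_ord_widen r (fun i => W (n + i - b)%N - W (n + i - b.+1)%N)).
ring.
Qed.

Lemma kernel_window_row z : z *m bordered_mx n r 1 = 0 ->
  exists2 W, forall k, (k < n + r)%N -> W k = W (k %% s)%N & z = window_row W.
Proof.
pose X a i := submxrow (lsubmx z) a 0 i.
pose u j := lsubmx (rsubmx z) 0 j; pose v a := rsubmx (rsubmx z) 0 a.
have -> : z = row_mx (block_row X) (border_row u v).
  rewrite -[LHS]hsubmxK; congr row_mx; last first.
    rewrite -[LHS]hsubmxK /border_row.
    by congr row_mx; apply/rowP=> i; rewrite [RHS]mxE.
  rewrite -[LHS]submxrowK; apply: eq_mxrow => a.
  by apply/rowP=> i; rewrite [RHS]mxE.
case/bordered_kernelP => row0 col0 cornerS.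
(* The staircase lemmas concern functions on all naturals, so [u] and [v] are extended by 0. *)
pose ext m (f : 'I_m -> F) k := if insub k is Some i then f i else 0.
have extE m (f : 'I_m -> F) (i : 'I_m) : ext m f i = f i by rewrite /ext valK.
pose W := window n (ext r u) (ext n v).
have cS a j : (a < n)%N -> (j < r)%N ->
  corner X a.+1 j.+1 = corner X a j + ext r u j + ext n v a.
  move=> lt_a lt_j; rewrite -[a]/(val (Ordinal lt_a)) -[j]/(val (Ordinal lt_j)).
  by rewrite !extE cornerS.
exists W.
  apply: (@window_periodic F n r (ext r u) (ext n v) (corner X)) => // *;
    by rewrite ?corner0l ?corner0r ?corner_n ?corner_r.
have cE a j : (a <= n)%N -> (j <= r)%N -> corner X a j = stair n W a j.
  by apply: stairP => // *; rewrite ?corner0l ?corner0r.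
rewrite /window_row; congr row_mx; last first.
  congr row_mx; apply/rowP=> i; rewrite !mxE /W /window.
    by rewrite ltnNge leq_addr /= addKn extE.
  have -> : (n - i.+1 < n)%N by have := ltn_ord i; lia.
  rewrite opprK (_ : (n - (n - i.+1).+1)%N = i) ?extE //.
  by have := ltn_ord i; lia.
apply: eq_block_row => a i.
have lt_a := ltn_ord a; have lt_i := ltn_ord i.
(* [X] is recovered from its corners, already known to be [stair], by a mixed second difference. *)
have : X a i = corner X a.+1 i.+1 - corner X a i.+1 - (corner X a.+1 i - corner X a i).
  by rewrite !cornerSl sum_ord_ltS; ring.
move->; rewrite !cE; try lia.
rewrite /stair addnS subSS !psumS.
have -> : ((n + i).+1 - a = (n + i - a).+1)%N by lia.
have -> : (n + i - a = (n + i - a.+1).+1)%N by lia.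
rewrite !psumS; ring.
Qed.

End BorderedKernel.

(** * Rank of the bordered matrix with c = 1 over any field *)

Section BorderedRank.

Variables (F : fieldType) (n r : nat).
Hypothesis n_gt0 : (0 < n)%N.
Local Notation s := (gcdn n r).

Let s_gt0 : (0 < s)%N. Proof. by rewrite gcdn_gt0 n_gt0. Qed.

Lemma eq_window_row (W W' : nat -> F) :
  (forall k, (k < n + r)%N -> W k = W' k) -> window_row n r W = window_row n r W'.
Proof.
move=> eqW; congr row_mx.
  apply: eq_block_row => a i; have := ltn_ord a; have := ltn_ord i => ? ?.
  by rewrite !eqW //; lia.
congr row_mx; apply/rowP=> i; rewrite !mxE eqW //; have := ltn_ord i; lia.
Qed.

Lemma window_row_sum m (c : 'I_m -> F) (W : 'I_m -> nat -> F) :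
  \sum_t c t *: window_row n r (W t) = window_row n r (fun k => \sum_t c t * W t k).
Proof.
apply/rowP=> k; rewrite summxE.
have [j ->|l ->] := split_ordP k.
  rewrite /window_row row_mxEl !mxE -sumrB.
  by apply: eq_bigr => t _; rewrite mxE row_mxEl !mxE mulrBr.
rewrite /window_row row_mxEr; have [j ->|b ->] := split_ordP l.
  rewrite /border_row row_mxEl !mxE.
  by apply: eq_bigr => t _; rewrite mxE row_mxEr row_mxEl !mxE.
rewrite /border_row row_mxEr !mxE -sumrN.
by apply: eq_bigr => t _; rewrite mxE !row_mxEr !mxE mulrN.
Qed.

(** Indicators of the residue classes modulo s form a basis of the s-periodic functions. *)
Definition window_basis : 'M[F]_(s, \sum_(a < n) r + (r + n)) :=
  \matrix_t window_row n r (fun k => (k %% s == t)%N%:R).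

Lemma mul_window_basis (c : 'rV_s) :
  c *m window_basis
  = window_row n r (fun k => c 0 (Ordinal (ltn_pmod k s_gt0))).
Proof.
transitivity (\sum_t c 0 t *: window_row n r (fun k => (k %% s == t)%N%:R)).
  by rewrite mulmx_sum_row; apply: eq_bigr => t _; rewrite rowK.
rewrite window_row_sum; apply: eq_window_row => k _.
rewrite (bigD1 (Ordinal (ltn_pmod k s_gt0))) //= eqxx mulr1 big1 ?addr0 // => t.
by rewrite -val_eqE /= eq_sym => /negPf->; rewrite mulr0.
Qed.

Lemma window_basis_free : row_free window_basis.
Proof.
apply: inj_row_free => c; rewrite mul_window_basis => c0.
have le_sn : (s <= n)%N by rewrite dvdn_leq ?dvdn_gcdl.
apply/rowP=> t; have lt_ts := ltn_ord t.
(* The v-entry of index n-1-t is -W(t), which is minus the coefficient c_t as t < s <= n. *)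
have lt_b : (n - t.+1 < n)%N by lia.
have := congr1 (fun z => rsubmx (rsubmx z) 0 (Ordinal lt_b)) c0.
rewrite /window_row /border_row !row_mxKr !mxE /= => /eqP; rewrite oppr_eq0 => /eqP <-.
by congr (c _ _); apply: val_inj; rewrite /= modn_small; lia.
Qed.

Lemma rank_bordered1 : (\rank (bordered_mx n r (1 : F)) = (n * r + (r + n)) - s)%N.
Proof.
have -> : (n * r = \sum_(a < n) r)%N by rewrite sum_nat_const card_ord.
set H := bordered_mx _ _ _; rewrite -[LHS](subKn (rank_leq_row H)).
rewrite -mxrank_ker; congr (_ - _)%N.
rewrite -[RHS](eqP window_basis_free); apply/eqmx_rank/andP; split.
  apply/row_subP=> i; have := mulmx_ker H; move/(congr1 (row i)).
  rewrite row_mul row0 => /kernel_window_row[W Ws ->].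
  suff -> : window_row n r W = (\row_t W t) *m window_basis by apply: submxMl.
  by rewrite mul_window_basis; apply: eq_window_row => k /Ws->; rewrite mxE.
apply/sub_kermxP/row_matrixP => t; rewrite row_mul row0 rowK.
by apply: window_row_kernel => k; rewrite modnDr.
Qed.

End BorderedRank.

(** * Rank of the border *)

(** A vector (u, v) killed by the transpose satisfies u_j + v_b = 0 for all j and b, so it is a
    multiple of the vector with u = 1 and v = -1. *)
Lemma rank_incidence (F : fieldType) n r : (0 < n)%N -> (0 < r)%N ->
  \rank (incidence_mx F n r) = (n + r - 1)%N.
Proof.
move=> n_gt0 r_gt0; pose a0 := Ordinal n_gt0; pose j0 := Ordinal r_gt0.
rewrite -mxrank_tr; set B := _^T; rewrite -[LHS](subKn (rank_leq_row B)).
rewrite [(n + r)%N]addnC -mxrank_ker; congr (_ - _)%N.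
pose w := border_row (fun _ : 'I_r => 1 : F) (fun _ : 'I_n => -1).
have nz_w : w != 0.
  apply: contraNneq (oner_neq0 F) => /(congr1 (fun z => lsubmx z 0 j0)).
  by rewrite /w /border_row row_mxKl !mxE => ->.
have -> : 1%N = \rank w by rewrite rank_rV nz_w.
apply/eqmx_rank/andP; split; last first.
  apply/sub_kermxP; rewrite border_row_incidence -[RHS]mxrow0.
  by apply: eq_mxrow => b; apply/rowP=> j; rewrite !mxE subrr.
apply/row_subP=> i; have := mulmx_ker B; move/(congr1 (row i)).
rewrite row_mul row0; set z := row i _ => zB0.
pose u j := lsubmx z 0 j; pose v b := rsubmx z 0 b.
have def_z : z = border_row u v.
  rewrite -[LHS]hsubmxK /border_row.
  by congr row_mx; apply/rowP=> k; rewrite [RHS]mxE.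
have uv j b : u j + v b = 0.
  move: zB0; rewrite def_z border_row_incidence.
  move/(congr1 (fun y => submxrow y b 0 j)).
  by rewrite /block_row mxrowK mxE => ->; rewrite !mxE.
have eq_v b : v b = - u j0 by apply/eqP; rewrite -addr_eq0 addrC uv.
have eq_u j : u j = u j0.
  by apply/eqP; rewrite -subr_eq0 -(eq_v a0) uv.
suff -> : z = u j0 *: w by apply: scalemx_sub.
rewrite def_z /w /border_row scale_row_mx; congr row_mx; apply/rowP=> k.
  by rewrite !mxE eq_u mulr1.
by rewrite !mxE eq_v mulrN1.
Qed.

Lemma rank_antidiag_block (F : fieldType) m p (B : 'M[F]_(m, p)) (C : 'M[F]_(p, m)) :
  \rank (block_mx 0 B C 0) = (\rank B + \rank C)%N.
Proof.
pose P : 'M[F]_(m + p, p + m) := block_mx 0 1%:M 1%:M 0.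
pose Q : 'M[F]_(p + m, m + p) := block_mx 0 1%:M 1%:M 0.
have PQ : P *m Q = 1%:M.
  by rewrite mulmx_block !(mul0mx, mulmx0, mul1mx, add0r, addr0) -scalar_mx_block.
rewrite -rank_diag_block_mx -(@mxrankMfree _ _ _ _ _ P); last first.
  by apply/row_freeP; exists Q.
by rewrite mulmx_block !(mul0mx, mulmx0, mulmx1, add0r, addr0).
Qed.

(** * Weak inverses, and the ranks of [HP] *)

Lemma blockdiag_cube N k : (k.*2 <= N)%N ->
  blockdiag N (nseq k 1) *m blockdiag N (nseq k 1) *m blockdiag N (nseq k 1)
  = - blockdiag N (nseq k 1).
Proof.
elim: k N => [|k IHk] N; first by rewrite blockdiag0 mulmx0 oppr0.
case: N => [|[|N]] // le_kN; rewrite -[nseq k.+1 _]/(1 :: nseq k 1).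
rewrite -[N.+2]/(2 + N)%N blockdiag_cons !mulmx_block.
rewrite !(mul0mx, mulmx0, addr0, add0r) scale1r IHk // blockdiag2_sqr mulNmx mul1mx.
by rewrite opp_block_mx !oppr0.
Qed.

(** A prime dividing some h_i of the normal form would lower the rank modulo that prime, so all h_i
    are 1. The normal form D then satisfies D^3 = - D, which suggests - L D L^T as weak inverse. *)
Lemma skew_weak_inverse N (J : 'M[int]_N) : J^T = - J ->
  (forall p, prime p -> \rank (map_mx (intr : int -> 'F_p) J)
                        = \rank (map_mx (intr : int -> rat) J)) ->
  exists G, J *m G *m J = J.
Proof.
move=> skJ rkJ; have [L [h [uL h_gt0 _ le_hN LJL]]] := skew_normal_form skJ.
have h1 : all (pred1 1) h.
  apply/allP => x xh; have x_gt0 := allP h_gt0 x xh.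
  apply/idPn => /= x_n1.
  have x_gt1 : (1 < `|x|)%N by move: x_gt0 x_n1 => /=; lia.
  have [p p_pr p_x] := pdivP x_gt1.
  have := rkJ _ p_pr; rewrite -!(rank_congr _ J uL) LJL !rank_blockdiag //.
  move/double_inj => eq_c.
  have: all (fun y : int => y%:~R != 0 :> 'F_p) h.
    rewrite all_count eq_c -all_count; apply: sub_all h_gt0 => y y_gt0.
    by rewrite intr_eq0 lt0r_neq0.
  move=> /allP/(_ x xh) /=; rewrite -[x]gez0_abs ?ltW // -pmulrn.
  by rewrite -(dvdn_pcharf (pchar_Fp p_pr)) p_x.
have def_h : h = nseq (size h) 1 by apply/all_pred1P.
exists (- (L *m blockdiag N h *m L^T)).
have uLT : L^T \in unitmx by rewrite unitmx_tr.
apply: (can_inj (mulKmx uLT)); apply: (can_inj (mulmxK uL)).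
rewrite LJL mulmxN mulNmx mulmxN mulNmx !mulmxA LJL -(mulmxA _ L^T) -mulmxA.
by rewrite LJL def_h blockdiag_cube ?opprK // -def_h.
Qed.

Section RanksHP.

Variables n r : nat.
Hypotheses (n_gt0 : (0 < n)%N) (r_gt0 : (0 < r)%N).

Lemma bordered_scalel (R : comNzRingType) :
  bordered_mx n r (2 : R) *m block_mx 1%:M 0 0 2%:M
  = block_mx 2%:M 0 0 1%:M *m bordered_mx n r 1.
Proof.
rewrite !mulmx_block !(mul0mx, mulmx0, mulmx1, mul1mx, add0r, addr0) scale1r.
by rewrite mul_mx_scalar !mul_scalar_mx.
Qed.

Lemma bordered_scaler (R : comNzRingType) :
  block_mx 1%:M 0 0 2%:M *m bordered_mx n r (2 : R)
  = bordered_mx n r 1 *m block_mx 2%:M 0 0 1%:M.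
Proof.
rewrite !mulmx_block !(mul0mx, mulmx0, mulmx1, mul1mx, add0r, addr0) scale1r.
by rewrite !mul_mx_scalar !mul_scalar_mx.
Qed.

(** Moving each [E1] across its neighbour [HP] gives E2 H1 G1 H1 E2 = E2 H1 E2 = HP E1 E2, and E1 E2
    = 2. *)
Lemma HP_weak_inverse2 : exists G, HP n r *m G *m HP n r = 2 *: HP n r.
Proof.
have [|p p_pr|G1 G1P] := @skew_weak_inverse _ (bordered_mx n r 1).
- exact: tr_bordered.
- by rewrite !map_bordered !rank_bordered1.
rewrite HP_bordered; set H := bordered_mx n r 2.
pose E1 : 'M[int]_(\sum_(a < n) r + (r + n)) := block_mx 1%:M 0 0 2%:M.
pose E2 : 'M[int]_(\sum_(a < n) r + (r + n)) := block_mx 2%:M 0 0 1%:M.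
exists (E1 *m G1 *m E1).
have E12 : E1 *m E2 = 2%:M.
  rewrite mulmx_block !(mul0mx, mulmx0, mulmx1, mul1mx, add0r, addr0).
  by rewrite -scalar_mx_block.
rewrite !mulmxA bordered_scalel -/E2 -(mulmxA _ E1) bordered_scaler -/E2.
rewrite mulmxA -2!(mulmxA E2) G1P -bordered_scalel -/E1 -mulmxA E12.
by rewrite mul_mx_scalar.
Qed.

Lemma rank_HP_rat : \rank (map_mx (intr : int -> rat) (HP n r))
  = (n * r + (r + n) - gcdn n r)%N.
Proof.
rewrite HP_bordered map_bordered -(rank_bordered1 rat r n_gt0).
have unit2 : (2%:M : 'M[rat]_(r + n)) \in unitmx.
  by rewrite unitmxE det_scalar unitrX // unitfE.
have unit2' : (2%:M : 'M[rat]_(\sum_(a < n) r)) \in unitmx.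
  by rewrite unitmxE det_scalar unitrX // unitfE.
have := bordered_scalel rat; move/(congr1 mxrank).
rewrite mxrankMfree; last first.
  by rewrite row_free_unit unitmxE det_ublock det1 mul1r -unitmxE.
rewrite (eqmxMfull _ (A := block_mx 2%:M 0 0 1%:M)) //.
by rewrite row_full_unit unitmxE det_ublock det1 mulr1 -unitmxE.
Qed.

Lemma rank_HP_F2 : \rank (map_mx (intr : int -> 'F_2) (HP n r))
  = (n + r - 1).*2.
Proof.
rewrite HP_bordered map_bordered /bordered_mx.
have -> : (2%:~R : 'F_2) = 0 by apply/eqP.
rewrite scale0r rank_antidiag_block mxrank_opp mxrank_tr rank_incidence //.
by rewrite addnn.
Qed.

End RanksHP.

(** * Counting the blocks and identifying the normal form *)

Lemma sorted_nseq12 a b : sorted <=%R (nseq a (1 : int) ++ nseq b (2 : int)).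
Proof.
have path2 m : path <=%R (2 : int) (nseq m 2) by elim: m.
case: a => [|a]; first by case: b => //= b; apply: path2.
by elim: a => //=; case: b => //= b; apply: path2.
Qed.

Theorem proposition4p11 (n r : nat) (hn : (0 < n)%N) (hr : (0 < r)%N) :
  let ones := (n + r - 1)%N in
  let twos := (((n - 1) * (r - 1) + 1 - gcdn n r) %/ 2)%N in
  is_block_diagonal_form (HP n r) (nseq ones 1 ++ nseq twos 2) /\
  (forall h : seq int, is_block_diagonal_form (HP n r) h ->
     perm_eq [seq `|x| | x <- h] (nseq ones (1 : int) ++ nseq twos (2 : int))).
Proof.
move=> ones twos.
have skH : (HP n r)^T = - HP n r by rewrite HP_bordered tr_bordered.
have [L [h [uL h_gt0 sh le_hN LHL]]] := skew_normal_form skH.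
have [G HGH] := HP_weak_inverse2 r hn.
have nz_h : all (fun x => x != 0) h by apply: sub_all h_gt0 => x /lt0r_neq0.
have rkh F := rank_congr F (HP n r) uL.
have rkQ : \rank (map_mx (intr : int -> rat) (HP n r)) = (size h).*2.
  rewrite -rkh LHL rank_blockdiag //; congr _.*2; apply/eqP; rewrite -all_count.
  by apply: sub_all nz_h => x; rewrite intr_eq0.
have sz_h : size h = (ones + twos)%N.
  have := rkQ; rewrite rank_HP_rat // /ones /twos.
  have : (gcdn n r <= n)%N by rewrite dvdn_leq ?dvdn_gcdl.
  have [m ->] : exists m, n = m.+1 by exists n.-1; lia.
  have [q ->] : exists q, r = q.+1 by exists r.-1; lia.
  rewrite !subn1 /= mulSn mulnS.
  have : (gcdn m.+1 q.+1 <= q.+1)%N by rewrite dvdn_leq ?dvdn_gcdr.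
  move: (gcdn _ _) (size h) => g k le_gq le_gm.
  (* This bound keeps the subtraction in [twos] from being truncated; the division by 2 is exact
     because the rank is the even number 2k. *)
  have : (g <= m * q + 1)%N by case: m le_gm => [|m] le_gm; nia.
  by move: (m * q)%N => mq; lia.
have corankE : (\sum_(a < n) r + (r + n) - corank (HP n r) = (size h).*2)%N.
  by rewrite /corank rkQ subKn // -rkQ rank_leq_row.
have form_h : is_block_diagonal_form (HP n r) h.
  by split=> //; exists L; split=> //; apply/det_pm1_unitmx.
have uniq h' : is_block_diagonal_form (HP n r) h' ->
    perm_eq [seq `|x| | x <- h'] (nseq ones 1 ++ nseq twos 2).
  by apply: block_diagonal_form_perm HGH _ _; rewrite ?rkQ ?sz_h ?rank_HP_F2.
(* The positive sorted normal form [h] is a permutation of the sorted explicit list, hence equal to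
   it. *)
split=> //; suff <- : h = nseq ones 1 ++ nseq twos 2 by [].
have abs_h : [seq `|x| | x <- h] = h.
  by rewrite -[RHS]map_id; apply/eq_in_map => x /(allP h_gt0) x0; rewrite gtr0_norm.
apply: (sorted_eq le_trans le_anti) => //; last by rewrite -{1}abs_h uniq.
exact: sorted_nseq12.
Qed.
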